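(* Suppose that the support $\mathcal S=\{a\in\mathcal A:p_a>0\}$ is infinite. Assume that, for some $\alpha\in[0,1]$ and some non-increasing function $\ell$ slowly varying at $+\infty$, we have $\nu(\varepsilon)\le \varepsilon^{-\alpha}\ell(1/\varepsilon)$ for all $0<\varepsilon\le 1$. Then, for all integers $n\ge 2$ and all $t>0$, $$M_{n,0}\le\left(e^{-1}+4\gamma\left(1-\alpha,\tfrac{1}{2}\right)\right) \frac{\ell(n)}{n^{1-\alpha}}+\sqrt{\frac{t}{n}}$$ with probability at least $1-e^{-t}$.
   Context: $\mathcal A$ is an at most countable set and $P=\{p_a:a\in\mathcal A\}$ is a probability distribution on $\mathcal A$ ($p_a\in[0,1]$, $\sum_{a}p_a=1$). $X_1,\dots,X_n$ are i.i.d. $\mathcal A$-valued random variables with distribution $P$; $\xi_n(a)=\sum_{i=1}^n\mathbf 1\{X_i=a\}$. The missing mass is $M_{n,0}=\sum_{a\in\mathcal A}p_a\mathbf 1\{\xi_n(a)=0\}$. The counting function of $P$ is $\nu(\varepsilon)=|\{a\in\mathcal A:p_a\ge\varepsilon\}|$. A function $\ell:[0,+\infty)\to\mathbb R$ is slowly varying at $+\infty$ if $\ell(cx)/\ell(x)\to1$ as $x\to+\infty$ for every $c>0$. The lower incomplete Gamma function is $\gamma(t,x)=\int_0^x u^{t-1}e^{-u}\,\mathrm du$, with $\gamma(0,\tfrac12)=+\infty$. *)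

(* Defs.v *)
From HB Require Import structures.
From mathcomp Require Import all_boot all_order all_algebra.
From mathcomp Require Import all_classical all_reals all_analysis.

Set Implicit Arguments.
Unset Strict Implicit.
Unset Printing Implicit Defensive.

Import Order.TTheory GRing.Theory Num.Theory.
Import numFieldNormedType.Exports.

Local Open Scope classical_set_scope.
Local Open Scope ring_scope.

Section Distributions.
Context {R : realType} {A : countType}.
Implicit Type p : A -> R.

Definition is_distribution p : Prop :=
  (forall a, 0 <= p a <= 1) /\
  (\esum_(a in [set: A]) (p a)%:E = 1)%E.

Definition supporting_set p : set A := [set a | 0 < p a].

Definition counting_function p (eps : R) : \bar R :=
  counting [set a | eps <= p a].

End Distributions.

Section Samples.
Context {d : measure_display} {Omega : measurableType d} {R : realType}
  {A : countType} {n : nat}.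
Implicit Types (P : probability Omega R) (p : A -> R) (X : 'I_n -> Omega -> A).

(* The countable set A carries the discrete sigma-algebra. *)
Definition random_element (Y : Omega -> A) : Prop :=
  forall B : set A, measurable (Y @^-1` B).

Definition mutually_independent P X : Prop :=
  forall (J : {set 'I_n}) (B : 'I_n -> set A),
    P (\bigcap_(i in [set` J]) (X i @^-1` B i)) =
    (\prod_(i in J) P (X i @^-1` B i))%E.

Definition iid_sample P p X : Prop :=
  [/\ forall i, random_element (X i),
      forall i a, P (X i @^-1` [set a]) = (p a)%:E
    & mutually_independent P X].

Definition occurrences X (omega : Omega) (a : A) : nat :=
  (\sum_(i < n) (X i omega == a))%N.

Definition missing_mass p X (omega : Omega) : \bar R :=
  (\esum_(a in [set: A]) (p a * (occurrences X omega a == 0%N)%:R)%:E)%E.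

End Samples.

Section RealFunctions.
Context {R : realType}.

(* With x / 0 = 0, the limit forces l to be eventually nonzero. *)
Definition slowly_varying (l : R -> R) : Prop :=
  forall c : R, 0 < c -> l (c * x) / l x @[x --> +oo] --> (1 : R).

(* Extended-real valued: the integral diverges to +oo at t = 0 (and x > 0). *)
Definition lower_gamma (t x : R) : \bar R :=
  (\int[lebesgue_measure]_(u in `]0%R, x])
    ((u `^ (t - 1) * expR (- u))%R)%:E)%E.

End RealFunctions.

(* Main.v *)
Require Import Defs.
From HB Require Import structures.
From mathcomp Require Import all_boot all_order all_algebra.
From mathcomp Require Import all_classical all_reals all_analysis.
From mathcomp Require Import measurable_realfun.
From mathcomp Require Import ring lra.

Set Implicit Arguments.
Unset Strict Implicit.
Unset Printing Implicit Defensive.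

Import Order.TTheory GRing.Theory Num.Theory.
Import numFieldNormedType.Exports.

Local Open Scope classical_set_scope.
Local Open Scope ring_scope.

(** The proof is an exponential moment bound in which the mean of the missing
    mass is never computed: it is replaced, atom by atom, by the upper bound
    min(2 p_a, 1/n), and this slack makes the moment estimate elementary.

    Write q_a = (1 - p_a)^n, fix lam >= 0 and let F be a finite set of atoms
    with missing mass M_F.  Expanding exp(lam M_F) as the product over F of
    1 + (exp(lam p_a) - 1) 1{a unseen} and taking expectations gives a
    combination, with nonnegative coefficients, of the probabilities that all
    of S is unseen, for S included in F.  Such a probability is
    (1 - sum_S p_a)^n, which is at most the product of the q_a over S.  Hence
    the exponential moment is at most the product over F of
    1 + (exp(lam p_a) - 1) q_a ([integral_unseen_weights_le]).

    Each factor is at most exp(lam min(2 p_a, 1/n) + lam^2 p_a / (4 n))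
    ([atom_mgf_le]).  As the p_a sum to at most 1, Markov's inequality with
    lam = 2 sqrt(n t) yields, for any B that dominates all the finite sums of
    the min(2 p_a, 1/n), that M_F > B + sqrt(t / n) has probability at most
    exp(- t) ([missing_mass_on_tail]).  It is the factor p_a in the quadratic
    term that makes the deviation sqrt(t / n) independent of the alphabet.

    Finally B can be taken to be 4 gamma(1 - alpha, 1/2) l(n) / n^(1 - alpha)
    ([sum_min_le_gamma]).  For u <= 1/2 the number of atoms with n p_a >= u is
    nu(u/n) <= (u/n)^(- alpha) l(n/u) <= u^(- alpha) n^alpha l(n), because l
    does not increase; integrating this over u in ]0, 1/2], with the weight
    exp(- u) >= 1/2 inserted on the right, bounds the sum of the
    min(n p_a, 1/2).  The full alphabet is reached by monotone continuity of
    the probability along an exhaustion by finite sets of atoms. *)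

(** * Exponential moment of one atom *)

Section AtomBound.
Context {R : realType}.
Implicit Types p q x w lam : R.

Lemma expR_chord x w : 0 <= x <= w -> 0 < w ->
  expR x - 1 <= x / w * (expR w - 1).
Proof.
move=> /andP[x0 xw] w0.
have t0 : 0 <= x / w by rewrite divr_ge0// ltW.
have t1 : x / w <= 1 by rewrite ler_pdivrMr// mul1r.
have : expR (x / w * w + (1 - x / w) * 0) <=
    x / w * expR w + (1 - x / w) * expR 0 :> R.
  exact: (convex_expR (@Itv01 R (x / w) t0 t1) (w : R^o) (0 : R^o)).
rewrite expR0 mulr0 addr0 mulr1.
have -> : x / w * w = x by rewrite divfK// gt_eqF.
lra.
Qed.

(** Here x = lam p and w = n p.  The two regimes use different terms of the
    exponent: when x <= w the linear term x / w dominates by the chord bound,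
    and when x > w the factor exp(x - w) is absorbed by the quadratic term,
    while x / w > 1 pays for the remaining factor 2. *)
Lemma heavy_atom_mgf_le x w q : 0 <= x -> 0 < w -> 0 <= q -> q <= expR (- w) ->
  1 + (expR x - 1) * q <= expR (x / w + x ^+ 2 / (4 * w)).
Proof.
move=> x0 w0 q0 qw.
have ex1 : 0 <= expR x - 1.
  by have := expR_ge1Dx x; lra.
have e1 : (expR x - 1) * q <= (expR x - 1) * expR (- w) by rewrite ler_wpM2l.
have [xw|wx] := leP x w.
- have c : (expR x - 1) * expR (- w) <= x / w.
    rewrite expRN ler_pdivrMr ?expR_gt0//.
    apply: (le_trans (expR_chord _ w0)); first by rewrite x0.
    rewrite ler_wpM2l//; first by rewrite divr_ge0// ltW.
    by lra.
  apply: (@le_trans _ _ (1 + x / w)); first by lra.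
  apply: (le_trans (expR_ge1Dx _)); rewrite ler_expR lerDl.
  by rewrite divr_ge0 ?sqr_ge0// mulr_ge0// ltW.
- have e2 : (expR x - 1) * expR (- w) = expR (x - w) - expR (- w).
    by rewrite mulrBl mul1r -expRD.
  have e3 : 1 <= expR (x - w) by rewrite -expR0 ler_expR; lra.
  have e4 := expR_gt0 (- w).
  have e5 : 2 <= expR 1 :> R by have := expR_ge1Dx (1 : R); lra.
  apply: (@le_trans _ _ (expR 1 * expR (x - w))).
    apply: (@le_trans _ _ (2 * expR (x - w))); first by lra.
    by rewrite ler_wpM2r// expR_ge0.
  rewrite -expRD ler_expR lerD//.
    by rewrite ler_pdivlMr// mul1r ltW.
  (* 4 w (x - w) <= x ^ 2 is (x - 2 w) ^ 2 >= 0 *)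
  rewrite ler_pdivlMr; last by lra.
  have := sqr_ge0 (x - 2 * w); nra.
Qed.

(** A light atom, with 2 p <= 1 / n, is handled as if it were surely unseen:
    the left-hand side is at most exp(lam p).  A heavy atom is unseen with
    probability at most exp(- n p). *)
Lemma atom_mgf_le (n : nat) p lam : (0 < n)%N -> 0 <= p <= 1 -> 0 <= lam ->
  1 + (expR (lam * p) - 1) * (1 - p) ^+ n <=
  expR (lam * Num.min (2 * p) n%:R^-1 + lam ^+ 2 / (4 * n%:R) * p).
Proof.
move=> n0 /andP[p0 p1] lam0.
have N0 : 0 < n%:R :> R by rewrite ltr0n.
have q0 : 0 <= (1 - p) ^+ n by rewrite exprn_ge0// subr_ge0.
have q1 : (1 - p) ^+ n <= 1 by rewrite exprn_ile1// ?subr_ge0// gerBl.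
have x0 : 0 <= lam * p by rewrite mulr_ge0.
have [light|heavy] := leP (2 * p) n%:R^-1.
- have ex1 : 0 <= expR (lam * p) - 1.
    by have := expR_ge1Dx (lam * p); lra.
  apply: (@le_trans _ _ (expR (lam * p))); first by nra.
  rewrite ler_expR.
  have : 0 <= lam ^+ 2 / (4 * n%:R) * p.
    by rewrite mulr_ge0// divr_ge0 ?sqr_ge0// mulr_ge0// ltW.
  lra.
- have pgt0 : 0 < p by have : 0 < n%:R^-1 :> R; [rewrite invr_gt0|lra].
  apply: le_trans.
    apply: (@heavy_atom_mgf_le _ (n%:R * p)) => //; first by rewrite mulr_gt0.
    rewrite -mulrN mulrC expRM_natr lerXn2r ?nnegrE ?expR_ge0 ?subr_ge0//.
    exact: expR_ge1Dx.
  rewrite ler_expR le_eqVlt; apply/orP; left; apply/eqP.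
  by field; rewrite !gt_eqF.
Qed.

End AtomBound.

(** * The incomplete Gamma function as a bound for the mean *)

Section MeanBound.
Context {R : realType} {A : countType}.
Implicit Types (p : A -> R) (s : seq A).

Lemma size_le_counting s (S : set A) : uniq s -> (forall a, a \in s -> S a) ->
  ((size s)%:R%:E <= counting S :> \bar R)%E.
Proof.
move=> us sS; rewrite /counting; case: asboolP => [fS|_]; last exact: leey.
rewrite lee_fin ler_nat; apply: uniq_leq_size => // a /sS Sa.
by rewrite in_fset_set// mem_set.
Qed.

Lemma sum_indic_size_filter p s (N u : R) : 0 < u ->
  \sum_(a <- s) \1_`]0, N * p a] u = (size [seq a <- s | u <= N * p a])%:R :> R.
Proof.
move=> u0; rewrite size_filter -sum1_count natr_sum [RHS]big_mkcond/=.
apply: eq_bigr => a _; rewrite indicE mem_setE in_itv/= u0/=.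
by case: (u <= _).
Qed.

Lemma regular_bound_ge0 p (alpha : R) (l : R -> R) (N : R) :
  (forall eps : R, 0 < eps -> eps <= 1 ->
    (counting_function p eps <= (eps `^ (- alpha) * l (eps^-1))%:E)%E) ->
  1 <= N -> 0 <= l N.
Proof.
move=> nu_le N1.
have N0 : 0 < N by lra.
have e0 : 0 < N^-1 by rewrite invr_gt0.
have e1 : N^-1 <= 1 by rewrite invf_le1.
have cnt0 : (0 <= counting_function p N^-1)%E.
  exact: (@size_le_counting [::]).
have := le_trans cnt0 (nu_le _ e0 e1).
by rewrite invrK lee_fin pmulr_rge0 ?powR_gt0.
Qed.

(** The left-hand side counts the atoms of s with u / N <= p a.  The constant
    2 pays for the weight exp(- u) >= 1 - u >= 1 / 2 on the right. *)
Lemma sum_indic_le_regular p (alpha : R) (l : R -> R) s (N u : R) :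
  (forall a, 0 <= p a) -> uniq s ->
  {in `[0, +oo[ &, {homo l : x y /~ x <= y}} ->
  (forall eps : R, 0 < eps -> eps <= 1 ->
    (counting_function p eps <= (eps `^ (- alpha) * l (eps^-1))%:E)%E) ->
  1 <= N -> 0 < u <= 2^-1 ->
  \sum_(a <- s) \1_`]0, N * p a] u <=
  2 * N `^ alpha * l N * (u `^ (1 - alpha - 1) * expR (- u)).
Proof.
move=> p0 us l_noninc nu_le N1 /andP[u0 u12].
have N0 : 0 < N by lra.
have uN : 0 < u / N by rewrite divr_gt0.
rewrite sum_indic_size_filter//.
have lNu : l (u / N)^-1 <= l N.
  apply: l_noninc; rewrite ?in_itv/= ?andbT ?invr_ge0 ?(ltW uN) ?(ltW N0)//.
  by rewrite invf_div ler_pdivlMr//; nra.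
have cnt : (size [seq a <- s | u <= N * p a])%:R <= (u / N) `^ (- alpha) * l N.
  apply: (@le_trans _ _ ((u / N) `^ (- alpha) * l (u / N)^-1)); last first.
    by rewrite ler_wpM2l// powR_ge0.
  rewrite -lee_fin; apply: le_trans (nu_le _ uN _); last first.
    by rewrite ler_pdivrMr//; lra.
  rewrite /counting_function; apply: size_le_counting; first exact: filter_uniq.
  move=> a; rewrite mem_filter => /andP[uNp _] /=.
  by rewrite ler_pdivrMr// mulrC.
apply: (le_trans cnt).
have -> : 1 - alpha - 1 = - alpha by lra.
rewrite powRM ?invr_ge0 ?(ltW u0) ?(ltW N0)//.
have -> : N^-1 `^ (- alpha) = N `^ alpha.
  by rewrite -powR_inv1 ?(ltW N0)// -powRrM mulN1r opprK.
have lN0 : 0 <= l N by exact: regular_bound_ge0 nu_le N1.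
have e2 : 1 <= 2 * expR (- u) by have := expR_ge1Dx (- u); lra.
have Y : 0 <= u `^ (- alpha) * N `^ alpha * l N by rewrite !mulr_ge0 ?powR_ge0.
have -> : 2 * N `^ alpha * l N * (u `^ (- alpha) * expR (- u)) =
    u `^ (- alpha) * N `^ alpha * l N * (2 * expR (- u)) by ring.
by rewrite ler_peMr.
Qed.

Lemma integral_indic_itv (x b : R) : 0 <= x -> 0 <= b ->
  (\int[lebesgue_measure]_(u in `]0%R, b]) (\1_`]0, x] u)%:E =
   (Num.min x b)%:E)%E.
Proof.
move=> x0 b0; rewrite integral_indic//=.
rewrite (_ : _ `&` _ = `]0%R, Num.min x b]%classic).
  rewrite lebesgue_measure_itv/= lte_fin; case: ltP => [_|m0].
    by rewrite oppr0 adde0.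
  by congr (_%:E); apply/eqP; rewrite eq_le m0 le_min x0 b0.
apply/seteqP; split => u /=; rewrite !in_itv/= le_min.
  by move=> [/andP[-> ->] /andP[_ ->]].
by move=> /andP[-> /andP[-> ->]].
Qed.

(** Writing min(n p_a, 1/2) as the length of the set of u in ]0, 1/2] with
    u <= n p_a turns the sum over atoms into the integral of their count.  The
    integral may be infinite, whence the extended-real inequality. *)
Lemma sum_min_le_gamma p (alpha : R) (l : R -> R) s (n : nat) :
  (forall a, 0 <= p a) -> uniq s ->
  {in `[0, +oo[ &, {homo l : x y /~ x <= y}} ->
  (forall eps : R, 0 < eps -> eps <= 1 ->
    (counting_function p eps <= (eps `^ (- alpha) * l (eps^-1))%:E)%E) ->
  (0 < n)%N ->
  ((\sum_(a <- s) Num.min (2 * p a) n%:R^-1)%:E <=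
   4%:E * lower_gamma (1 - alpha) 2^-1 * (l n%:R / n%:R `^ (1 - alpha))%:E)%E.
Proof.
move=> p0 us l_noninc nu_le n0.
have N0 : 0 < n%:R :> R by rewrite ltr0n.
have N1 : 1 <= n%:R :> R by rewrite ler1n.
have lN0 : 0 <= l n%:R by exact: regular_bound_ge0 nu_le N1.
set C := 2 * n%:R `^ alpha * l n%:R.
have C0 : 0 <= C by rewrite !mulr_ge0 ?powR_ge0.
pose g (u : R) := u `^ (1 - alpha - 1) * expR (- u).
have mg : measurable_fun (`]0%R, 2^-1] : set R) (EFin \o g).
  apply/measurable_EFinP/measurable_funTS/measurable_funM.
    exact: measurable_powR.
  exact: measurableT_comp.
have key : ((\sum_(a <- s) Num.min (n%:R * p a) 2^-1)%:E <=
    C%:E * lower_gamma (1 - alpha) 2^-1)%E.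
  have -> : (C%:E * lower_gamma (1 - alpha) 2^-1 =
      \int[lebesgue_measure]_(u in `]0%R, 2^-1%R]) (C%:E * (EFin \o g) u))%E.
    rewrite ge0_integralZl_EFin// => u _.
    by rewrite lee_fin mulr_ge0 ?powR_ge0 ?expR_ge0.
  rewrite -sumEFin; under eq_bigr => a _.
    rewrite -integral_indic_itv ?mulr_ge0 ?invr_ge0//; over.
  rewrite -ge0_integral_sum//; last first.
    by move=> a; apply/measurable_EFinP/measurable_indic.
  apply: ge0_le_integral => //=.
  - by move=> u _; rewrite sumEFin lee_fin sumr_ge0.
  - by apply: emeasurable_sum => a; apply/measurable_EFinP/measurable_indic.
  - exact: measurable_funeM.
  - move=> u; rewrite in_itv/= => u12; rewrite sumEFin lee_fin.
    exact: sum_indic_le_regular.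
have -> : \sum_(a <- s) Num.min (2 * p a) n%:R^-1 =
    2 / n%:R * \sum_(a <- s) Num.min (n%:R * p a) 2^-1.
  rewrite mulr_sumr; apply: eq_bigr => a _.
  rewrite minr_pMr ?divr_ge0 ?ltW//; congr Num.min; field; rewrite ?gt_eqF//.
rewrite EFinM; apply: (@le_trans _ _
    ((2 / n%:R)%:E * (C%:E * lower_gamma (1 - alpha) 2^-1))%E).
  by rewrite lee_wpmul2l// lee_fin divr_ge0// ltW.
rewrite muleA -EFinM muleAC -EFinM.
rewrite (_ : 2 / _ * _ = 4 * (l n%:R / n%:R `^ (1 - alpha)))//.
rewrite /C powRD; last by apply/implyP => _; rewrite gt_eqF.
rewrite powRr1 ?(ltW N0)// powRN; field.
by rewrite !gt_eqF ?powR_gt0.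
Qed.

End MeanBound.

(** * Exhaustion of a countable alphabet by finite sets *)

Section FirstAtoms.
Context {A : countType}.

Definition first_atoms (k : nat) : seq A := pmap (@pickle_inv A) (iota 0 k).

Lemma first_atoms_uniq k : uniq (first_atoms k).
Proof.
by apply: (@pmap_uniq _ _ _ pickle); [exact: pickle_invK|exact: iota_uniq].
Qed.

Lemma mem_first_atoms k a : (a \in first_atoms k) = (pickle a < k)%N.
Proof.
rewrite mem_pmap; apply/mapP/idP => [[i ik e]|ak].
  have := @pickle_invK A i; rewrite -e /= => ->.
  by move: ik; rewrite mem_iota.
by exists (pickle a); rewrite ?mem_iota//= pickleK_inv.
Qed.

Lemma first_atomsD k m :
  first_atoms (k + m) = first_atoms k ++ pmap (@pickle_inv A) (iota k m).
Proof. by rewrite /first_atoms iotaD pmap_cat. Qed.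

End FirstAtoms.

(** * Exponential moment and tail of the missing mass *)

Section Unseen.
Context {d : measure_display} {Omega : measurableType d} {R : realType}
  {A : countType} {n : nat}.
Context (P : probability Omega R) (p : A -> R) (X : 'I_n -> Omega -> A).
Context (X_iid : iid_sample P p X).
Implicit Types (s S : seq A) (a : A).

(** The intersection is indexed by a set of indices so that mutual
    independence applies to it as it stands. *)
Definition unseen S : set Omega :=
  \bigcap_(i in [set` [set: 'I_n]%SET]) (X i @^-1` ~` [set` S]).

Lemma unseenP S omega :
  unseen S omega <-> forall i, X i omega \notin S.
Proof.
split=> [H i|H i _]; last exact/negP.
by apply/negP; apply: H; rewrite /= inE.
Qed.

Lemma unseen_nil : unseen [::] = setT.
Proof. by apply/seteqP; split=> // omega _; apply/unseenP => i. Qed.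

Lemma unseen_cons a S : unseen (a :: S) = unseen S `&` unseen [:: a].
Proof.
apply/seteqP; split=> omega.
  move=> /unseenP H; split; apply/unseenP => i; have := H i;
    by rewrite !inE negb_or => /andP[].
by move=> [/unseenP H1 /unseenP H2]; apply/unseenP => i;
  rewrite inE negb_or H1 andbT; have := H2 i; rewrite inE.
Qed.

Lemma occurrences0 a omega :
  (occurrences X omega a == 0%N)%:R = \1_(unseen [:: a]) omega :> R.
Proof.
rewrite indicE; congr ((nat_of_bool _)%:R); apply/idP/idP.
  rewrite sum_nat_eq0 => /forallP H; rewrite inE; apply/unseenP => i.
  by have := H i; rewrite inE /= eqb0.
rewrite inE => /unseenP H; rewrite sum_nat_eq0; apply/forallP => i /=.
by rewrite eqb0; have := H i; rewrite inE.
Qed.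

Lemma measurable_unseen S : measurable (unseen S).
Proof.
case: X_iid => mX _ _; apply: fin_bigcap_measurable => // i _; exact: mX.
Qed.
Hint Resolve measurable_unseen : core.

Lemma prob_preimage_seq i S : uniq S ->
  P (X i @^-1` [set` S]) = (\sum_(a <- S) p a)%:E.
Proof.
case: X_iid => mX Xp _; elim: S => [_|a S IH /= /andP[aS uS]].
  by rewrite big_nil set_nil preimage_set0 measure0.
have -> : X i @^-1` [set` a :: S] = X i @^-1` [set a] `|` X i @^-1` [set` S].
  by apply/seteqP; split=> omega /=; rewrite inE; [case/predU1P; [left|right]|
    case=> [->|->]; rewrite ?eqxx ?orbT].
transitivity (P (X i @^-1` [set a]) + P (X i @^-1` [set` S]))%E; last first.
  by rewrite Xp IH// big_cons EFinD.
apply: measureU; [exact: mX|exact: mX|].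
by apply/seteqP; split => // omega [/= -> /= aS']; rewrite aS' in aS.
Qed.

Lemma sum_prob_le1 S : (0 < n)%N -> uniq S -> \sum_(a <- S) p a <= 1.
Proof.
move=> n0 uS; rewrite -lee_fin -(prob_preimage_seq (Ordinal n0) uS).
by apply: probability_le1; case: X_iid => mX _ _; exact: mX.
Qed.

Lemma prob_unseen S : uniq S ->
  P (unseen S) = ((1 - \sum_(a <- S) p a) ^+ n)%:E.
Proof.
case: (X_iid) => mX _ indep uS.
have PXC i : P (X i @^-1` ~` [set` S]) = (1 - \sum_(a <- S) p a)%:E.
  rewrite preimage_setC probability_setC; last by exact: (mX i [set` S]).
  by rewrite prob_preimage_seq.
rewrite indep; under eq_bigr do rewrite PXC.
by rewrite prodEFin prodr_const cardsT card_ord.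
Qed.

Lemma onem_sum_le_prod S : (forall a, 0 <= p a <= 1) ->
  1 - \sum_(a <- S) p a <= \prod_(a <- S) (1 - p a).
Proof.
move=> p01; elim: S => [|a S IH]; first by rewrite !big_nil subr0.
rewrite !big_cons.
have /andP[a0 a1] := p01 a.
have S0 : 0 <= \sum_(a <- S) p a.
  by apply: sumr_ge0 => b _; case/andP: (p01 b).
apply: (@le_trans _ _ ((1 - p a) * (1 - \sum_(b <- S) p b))); first by nra.
by rewrite ler_wpM2l// subr_ge0.
Qed.

(** This is the only form of negative dependence between the events that
    atoms are unseen that the exponential moment requires: the probability that
    they occur together is at most the product of their probabilities. *)
Lemma prob_unseen_le_prod S :
  (forall a, 0 <= p a <= 1) -> (0 < n)%N -> uniq S ->
  (P (unseen S) <= (\prod_(a <- S) (1 - p a) ^+ n)%:E)%E.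
Proof.
move=> p01 n0 uS; rewrite prob_unseen// lee_fin prodrXl.
apply: lerXn2r; rewrite ?nnegrE ?subr_ge0 ?sum_prob_le1 ?onem_sum_le_prod//.
by apply: prodr_ge0 => a _; rewrite subr_ge0; case/andP: (p01 a).
Qed.

Definition unseen_weights (c : A -> R) s (omega : Omega) : R :=
  \prod_(a <- s) (1 + c a * \1_(unseen [:: a]) omega).

Lemma measurable_unseen_weights c s : measurable_fun setT (unseen_weights c s).
Proof.
rewrite /unseen_weights; elim: s => [|a s IH].
  by under eq_fun do rewrite big_nil; exact: measurable_cst.
under eq_fun do rewrite big_cons.
by apply: measurable_funM => //; apply: measurable_funD => //;
  apply: measurable_funM => //; exact: measurable_indic.
Qed.

Lemma unseen_weights_ge0 c s omega : (forall a, 0 <= c a) ->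
  0 <= unseen_weights c s omega.
Proof.
by move=> c0; apply: prodr_ge0 => a _; rewrite addr_ge0// mulr_ge0.
Qed.

(** Integrating over unseen S lets the product be expanded one factor at a
    time by induction on s: the term of c a restricts the domain to
    unseen (a :: S), and each domain left at the end is controlled by
    [prob_unseen_le_prod]. *)
Lemma integral_unseen_weights_le (c : A -> R) s S :
  (forall a, 0 <= p a <= 1) -> (0 < n)%N -> (forall a, 0 <= c a) ->
  uniq (s ++ S) ->
  (\int[P]_(omega in unseen S) (unseen_weights c s omega)%:E <=
   (\prod_(a <- S) (1 - p a) ^+ n *
    \prod_(a <- s) (1 + c a * (1 - p a) ^+ n))%:E)%E.
Proof.
move=> p01 n0 c0; elim: s S => [|a s IH] S us.
  under eq_integral do rewrite /unseen_weights big_nil.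
  by rewrite integral_cst// mul1e big_nil mulr1 prob_unseen_le_prod.
have us' : uniq (s ++ S) by move: us => /= /andP[].
have us'' : uniq (s ++ a :: S).
  by rewrite -[a :: S]cat1s uniq_catCA.
have mw : measurable_fun (unseen S) (EFin \o unseen_weights c s).
  by apply/measurable_EFinP/measurable_funTS/measurable_unseen_weights.
rewrite (_ : (fun omega => _) = (fun omega => (unseen_weights c s omega)%:E +
    (c a)%:E * ((EFin \o unseen_weights c s) \_ (unseen [:: a])) omega)%E);
  last first.
  apply/funext => omega; rewrite /unseen_weights big_cons patchE indicE.
  case: ifPn => _; rewrite ?mulr1 ?mulr0 ?mule0 ?adde0 ?addr0 ?mul1r//=.
  by rewrite -EFinM -EFinD mulrDl mul1r.
have mwa : measurable_fun (unseen S)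
    ((EFin \o unseen_weights c s) \_ (unseen [:: a])).
  apply/measurable_restrict => //.
  by apply/measurable_EFinP/measurable_funTS/measurable_unseen_weights.
rewrite ge0_integralD//; last 3 first.
  by move=> omega _; rewrite lee_fin unseen_weights_ge0.
  move=> omega _; rewrite mule_ge0// ?lee_fin// patchE; case: ifP => // _.
  by rewrite lee_fin unseen_weights_ge0.
  exact: measurable_funeM.
rewrite ge0_integralZl_EFin//; last first.
  move=> omega _; rewrite patchE; case: ifP => // _.
  by rewrite lee_fin unseen_weights_ge0.
rewrite -integral_mkcondr -unseen_cons.
apply: (le_trans (leeD (IH _ us') (lee_wpmul2l _ (IH _ us'')))).
  by rewrite lee_fin.
rewrite -EFinM -EFinD lee_fin !big_cons le_eqVlt; apply/orP; left; apply/eqP.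
ring.
Qed.

Definition missing_mass_on s (omega : Omega) : R :=
  \sum_(a <- s) p a * (occurrences X omega a == 0%N)%:R.

Lemma measurable_missing_mass_on s : measurable_fun setT (missing_mass_on s).
Proof.
apply: measurable_sum => a; under eq_fun do rewrite occurrences0.
by apply: measurable_funM => //; exact: measurable_indic.
Qed.

Lemma expR_missing_mass_on lam s omega :
  expR (lam * missing_mass_on s omega) =
  unseen_weights (fun a => expR (lam * p a) - 1) s omega.
Proof.
rewrite /missing_mass_on /unseen_weights mulr_sumr expR_sum.
apply: eq_bigr => a _; rewrite occurrences0 indicE.
case: (_ \in _); rewrite ?mulr1 ?mulr0 ?expR0 ?addr0//.
by rewrite addrC subrK.
Qed.

Lemma mgf_missing_mass_on_le lam s :
  (forall a, 0 <= p a <= 1) -> (0 < n)%N -> 0 <= lam -> uniq s ->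
  (\int[P]_omega (expR (lam * missing_mass_on s omega))%:E <=
   (expR (lam * \sum_(a <- s) Num.min (2 * p a) n%:R^-1 +
          lam ^+ 2 / (4 * n%:R)))%:E)%E.
Proof.
move=> p01 n0 lam0 us.
under eq_integral do rewrite expR_missing_mass_on.
rewrite -unseen_nil.
have c0 a : 0 <= expR (lam * p a) - 1.
  rewrite subr_ge0 -expR0 ler_expR mulr_ge0//; by case/andP: (p01 a).
apply: (le_trans (integral_unseen_weights_le p01 n0 c0 _)).
  by rewrite cats0.
rewrite lee_fin big_nil mul1r.
apply: (@le_trans _ _ (\prod_(a <- s)
   expR (lam * Num.min (2 * p a) n%:R^-1 + lam ^+ 2 / (4 * n%:R) * p a))).
  apply: ler_prod => a _; rewrite atom_mgf_le// andbT addr_ge0// mulr_ge0//.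
  by rewrite exprn_ge0// subr_ge0; case/andP: (p01 a).
rewrite -expR_sum ler_expR big_split/= -!mulr_sumr lerD2l.
rewrite ler_piMr ?sum_prob_le1// divr_ge0 ?sqr_ge0// mulr_ge0//.
Qed.

Lemma missing_mass_on_tail (B t : R) s :
  (forall a, 0 <= p a <= 1) -> (0 < n)%N -> 0 < t -> uniq s ->
  \sum_(a <- s) Num.min (2 * p a) n%:R^-1 <= B ->
  (P [set omega | B + Num.sqrt (t / n%:R) < missing_mass_on s omega]%R <=
   (expR (- t))%:E)%E.
Proof.
move=> p01 n0 t0 us sB.
have N0 : 0 < n%:R :> R by rewrite ltr0n.
set sigma := Num.sqrt (t / n%:R).
have sigma2 : sigma ^+ 2 = t / n%:R by rewrite sqr_sqrtr// divr_ge0// ltW.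
(* lam minimises - lam * sigma + lam ^ 2 / (4 * n) *)
pose lam := 2 * n%:R * sigma.
have lam0 : 0 <= lam by rewrite !mulr_ge0// sqrtr_ge0.
set D := [set _ | _].
have mD : measurable D.
  rewrite -[D]setTI; apply: (measurable_fun_ltr (f := cst _)) => //.
  exact: measurable_missing_mass_on.
have mE : measurable_fun setT
    (EFin \o (fun omega => expR (lam * missing_mass_on s omega))).
  apply/measurable_EFinP; apply: measurableT_comp => //.
  by apply: measurable_funM => //; exact: measurable_missing_mass_on.
have markov : ((expR (lam * (B + sigma)))%:E * P D <=
    \int[P]_omega (expR (lam * missing_mass_on s omega))%:E)%E.
  rewrite -integral_cst//; apply: (@le_trans _ _
    (\int[P]_(omega in D) (expR (lam * missing_mass_on s omega))%:E)%E).
    apply: ge0_le_integral => //.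
    - by move=> omega _; rewrite lee_fin expR_ge0.
    - exact: measurable_funTS.
    - by move=> omega /ltW Dw; rewrite lee_fin ler_expR ler_wpM2l.
  by apply: ge0_subset_integral => // omega _; rewrite lee_fin expR_ge0.
have := le_trans markov (mgf_missing_mass_on_le p01 n0 lam0 us).
rewrite -lee_pdivlMl ?expR_gt0// -expRN -EFinM -expRD => /le_trans; apply.
rewrite lee_fin ler_expR.
have -> : lam ^+ 2 / (4 * n%:R) = t.
  by rewrite /lam exprMn sigma2; field; rewrite gt_eqF.
have : lam * sigma = 2 * t.
  by rewrite /lam -mulrA -expr2 sigma2; field; rewrite gt_eqF.
have : lam * \sum_(a <- s) Num.min (2 * p a) n%:R^-1 <= lam * B.
  by rewrite ler_wpM2l.
lra.
Qed.

Lemma missing_mass_leP omega (c : R) : (forall a, 0 <= p a) ->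
  (missing_mass p X omega <= c%:E)%E <->
  forall k, missing_mass_on (first_atoms k) omega <= c.
Proof.
move=> p0; split=> [mc k|mc].
- rewrite -lee_fin; apply: le_trans mc.
  apply: esum_ge; exists [set` first_atoms k]; first by split; [exact: finite_seq|].
  by rewrite -fsbig_seq ?first_atoms_uniq// sumEFin.
- apply: ge_ereal_sup => _ [F [finF _] <-].
  pose k := (\max_(a <- finmap.enum_fset (fset_set F)) pickle a).+1.
  apply: (@le_trans _ _ (missing_mass_on (first_atoms k) omega)%:E); last first.
    by rewrite lee_fin.
  rewrite /missing_mass_on -sumEFin [leRHS]fsbig_seq ?first_atoms_uniq//.
  apply: lee_fsum_nneg_subset => //.
    move=> a; rewrite inE => Fa; rewrite inE /= mem_first_atoms ltnS.
    by apply: leq_bigmax_seq => //; rewrite in_fset_set//; exact: mem_set.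
  by move=> a _; rewrite lee_fin mulr_ge0.
Qed.

Lemma missing_mass_tail (B t : R) :
  (forall a, 0 <= p a <= 1) -> (0 < n)%N -> 0 < t ->
  (forall s, uniq s -> \sum_(a <- s) Num.min (2 * p a) n%:R^-1 <= B) ->
  ((1 - expR (- t))%:E <=
   P [set omega | missing_mass p X omega <=
                  (B + Num.sqrt (t / n%:R))%R%:E])%E.
Proof.
move=> p01 n0 t0 sB; set c := B + _.
have p0 a : 0 <= p a by case/andP: (p01 a).
pose F k := [set omega | missing_mass_on (first_atoms k) omega <= c].
have mF k : measurable (F k).
  rewrite -[F k]setTI; apply: (measurable_fun_ler (g := cst c)) => //.
  exact: measurable_missing_mass_on.
have -> : [set omega | missing_mass p X omega <= c%:E]%E = \bigcap_k F k.
  apply/seteqP; split=> omega.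
    by move=> /= /(missing_mass_leP _ _ p0) mc k _; exact: mc.
  by move=> Fc; apply/missing_mass_leP => // k; exact: Fc.
have PF k : ((1 - expR (- t))%:E <= P (F k))%E.
  have -> : F k = ~` [set omega | c < missing_mass_on (first_atoms k) omega].
    by apply/seteqP; split=> omega; rewrite /F /= leNgt => /negP.
  rewrite probability_setC; last first.
    rewrite (_ : [set _ | _] = ~` F k); first exact: measurableC.
    by apply/seteqP; split=> omega; rewrite /F /= ltNge => /negP.
  rewrite EFinB leeB//.
  apply: missing_mass_on_tail => //; first exact: first_atoms_uniq.
  by apply: sB; exact: first_atoms_uniq.
have F_noninc : nonincreasing_seq F.
  move=> k m km; apply/subsetPset => omega; apply: le_trans.
  rewrite -(subnKC km) first_atomsD /missing_mass_on big_cat/= lerDl.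
  by apply: sumr_ge0 => a _; rewrite mulr_ge0.
have cvgF : P (F k) @[k --> \oo] --> P (\bigcap_k F k).
  apply: nonincreasing_cvg_mu => //; last exact: bigcap_measurable.
  by rewrite (le_lt_trans (probability_le1 _ _)) ?ltry.
rewrite -(cvg_lim _ cvgF)//; apply: lime_ge.
  by apply/cvg_ex; exists (P (\bigcap_k F k)).
by apply: nearW.
Qed.

End Unseen.

(** * The missing mass under a regularly varying counting bound *)

Theorem corollary3p1 (R : realType) (A : countType) (p : A -> R)
  (p_distr : is_distribution p)
  (supp_inf : infinite_set (supporting_set p))
  (alpha : R) (alpha01 : 0 <= alpha <= 1)
  (l : R -> R)
  (l_noninc : {in `[0, +oo[ &, {homo l : x y /~ x <= y}})
  (l_slow : slowly_varying l)
  (nu_le : forall eps : R, 0 < eps -> eps <= 1 ->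
    (counting_function p eps <= (eps `^ (- alpha) * l (eps^-1))%:E)%E)
  (n : nat) (n_ge2 : (2 <= n)%N)
  (d : measure_display) (Omega : measurableType d) (P : probability Omega R)
  (X : 'I_n -> Omega -> A) (X_iid : iid_sample P p X)
  (t : R) (t_gt0 : 0 < t) :
  ((1 - expR (- t))%:E <=
   P [set omega | missing_mass p X omega <=
        ((expR (- 1))%:E + 4%:E * lower_gamma (1 - alpha)%R 2^-1) *
          (l n%:R / n%:R `^ (1 - alpha))%:E
        + (Num.sqrt (t / n%:R))%:E])%E.
Proof.
have [p01 _] := p_distr.
have p0 a : 0 <= p a by case/andP: (p01 a).
have n0 : (0 < n)%N by exact: ltnW.
set L := l n%:R / n%:R `^ (1 - alpha).
have L0 : 0 <= L.
  by rewrite divr_ge0 ?powR_ge0// (regular_bound_ge0 nu_le)// ler1n.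
set G := (_ * L%:E)%E.
have sG s : uniq s -> ((\sum_(a <- s) Num.min (2 * p a) n%:R^-1)%:E <= G)%E.
  move=> us; apply: (le_trans (sum_min_le_gamma p0 us l_noninc nu_le n0)).
  by rewrite lee_wpmul2r ?lee_fin// leeDr// lee_fin expR_ge0.
(* An infinite lower_gamma can make G infinite, in which case the event is
   certain; the empty sum excludes -oo. *)
case: G sG => [g||] sG.
- by rewrite -EFinD; apply: missing_mass_tail => // s /sG.
- rewrite (_ : [set _ | _] = setT).
    by rewrite probability_setT lee_fin gerBl expR_ge0.
  by apply/seteqP; split=> // omega _ /=; rewrite leey.
- by have := sG [::] isT; rewrite leeNy_eq.
Qed.
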